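(* Let $E \subset \mathbb{R}^d$ be a compact domain, let $\theta:\mathbb{R}_+\to\mathbb{R}_+$ be a modulus of continuity (continuous, increasing, subadditive, $\theta(0)=0$), and let $(\Omega,\mathcal{F},\{\mathcal{F}_n\}_{n\ge 0},\mathcal{P})$ be a filtered probability space such that both the probability space and the filtration are complete. Let $\{(\xi_n(x), x\in E)\}_{n\ge 0}$ be a sequence of (real-valued) random fields on this space such that, for every $n$, the realizations of $\xi_n$ admit the modulus of continuity $\theta$ almost surely. Set $$M_n = \sup_{x\in E}|\xi_n(x)| + \sup_{x,y\in E,\ x\ne y}\frac{|\xi_n(x)-\xi_n(y)|}{\theta(|x-y|)},$$ and assume that $(\xi_n(x))_{n\ge 0}$ is a martingale with respect to $\{\mathcal{F}_n\}_{n\ge 0}$ for every fixed $x\in E$. If $$\sup_n \mathbb{E}[M_n] < +\infty,$$ then there exists a random field $(\xi(x), x\in E)$ such that its realizations admit the modulus of continuity $\theta$ almost surely and such that $$(\xi_n(x), x\in E)\underset{n\to\infty}{\longrightarrow}(\xi(x), x\in E)$$ pointwise almost surely, i.e., almost surely, $\xi_n(x)\to\xi(x)$ as $n\to\infty$ for all $x\in E$ simultaneously.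
   Context: A modulus of continuity (here always understood to be continuous, increasing, and subadditive) is a continuous increasing function $\theta:\mathbb{R}_+\to\mathbb{R}_+$ with $\theta(0)=0$ and $\theta(x+y)\le\theta(x)+\theta(y)$ for all $x,y\in\mathbb{R}_+$. A function $f$ on a compact domain $E\subset\mathbb{R}^d$ admits the modulus of continuity $\theta$ if and only if $$\sup_{x\ne y}\frac{|f(x)-f(y)|}{\theta(|x-y|)}<+\infty,$$ the supremum being over $x,y\in E$. Convergence of random fields ''pointwise almost surely'' means that there is a single event of probability one (not depending on $x$) on which $\xi_n(x)\to\xi(x)$ for every $x\in E$. Time is discrete ($n=0,1,2,\dots$). *)

(* Defs.v *)
(* MathComp-Analysis *)
From HB Require Import structures.
From mathcomp Require Import all_boot all_order all_algebra.
From mathcomp Require Import all_classical all_reals all_analysis.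

Set Implicit Arguments.
Unset Strict Implicit.
Unset Printing Implicit Defensive.

Import Order.TTheory GRing.Theory Num.Theory.
Import numFieldNormedType.Exports.

Local Open Scope classical_set_scope.
Local Open Scope ring_scope.

(* The library norm on row vectors is the sup norm, hence this definition. *)
Definition euclidean_norm (R : realType) (d : nat) (x : 'rV[R]_d) : R :=
  Num.sqrt (\sum_(i < d) x ord0 i ^+ 2).

(* A function R_+ -> R_+ is represented by its values on [0, +oo[; the values
   of theta at negative arguments are irrelevant.  "Increasing" is taken in
   the weak sense, so that strictly increasing theta are included. *)
Definition modulus_of_continuity (R : realType) (theta : R -> R) : Prop :=
  [/\ (forall t, 0 <= t -> 0 <= theta t),
      {within `[0, +oo[, continuous theta},
      (forall s t, 0 <= s -> s <= t -> theta s <= theta t),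
      theta 0 = 0 &
      (forall s t, 0 <= s -> 0 <= t -> theta (s + t) <= theta s + theta t)].

(* Supremum in [0, +oo] of a set of nonnegative extended reals; adjoining 0
   only matters for the empty set, whose supremum is then 0 and not -oo. *)
Definition sup_nneg (R : realType) (A : set (\bar R)) : \bar R :=
  ereal_sup (0%E |` A).

Definition sup_norm (R : realType) (d : nat) (E : set 'rV[R]_d)
    (f : 'rV[R]_d -> R) : \bar R :=
  sup_nneg [set `|f x|%:E | x in E].

(* The quotient is taken in extended reals, where a / 0 = +oo for a > 0 and
   0 / 0 = 0: if theta vanishes identically, only constant functions have a
   finite seminorm. *)
Definition modulus_seminorm (R : realType) (d : nat) (E : set 'rV[R]_d)
    (theta : R -> R) (f : 'rV[R]_d -> R) : \bar R :=
  sup_nneg [set r | exists x y, [/\ E x, E y, x != y &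
    r = (`|f x - f y|%:E / (theta (euclidean_norm (x - y)))%:E)%E]].

Definition admits_modulus (R : realType) (d : nat) (E : set 'rV[R]_d)
    (theta : R -> R) (f : 'rV[R]_d -> R) : Prop :=
  (modulus_seminorm E theta f < +oo)%E.

(* Only the indices x in E are meaningful. *)
Definition random_field (R : realType) (d : nat) (disp : measure_display)
    (Omega : measurableType disp) (E : set 'rV[R]_d)
    (xi : 'rV[R]_d -> Omega -> R) : Prop :=
  forall x, E x -> measurable_fun [set: Omega] (xi x).

Definition filtration (disp : measure_display) (Omega : measurableType disp)
    (F : nat -> set (set Omega)) : Prop :=
  [/\ (forall n, sigma_algebra [set: Omega] (F n)),
      (forall n, F n `<=` measurable) &
      (forall m n, (m <= n)%N -> F m `<=` F n)].

Definition complete_filtration (R : realType) (disp : measure_display)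
    (Omega : measurableType disp) (P : probability Omega R)
    (F : nat -> set (set Omega)) : Prop :=
  forall n, P.-negligible `<=` F n.

Definition measurable_wrt (R : realType) (disp : measure_display)
    (Omega : measurableType disp) (G : set (set Omega)) (X : Omega -> R) : Prop :=
  forall B : set R, measurable B -> G (X @^-1` B).

(* Y is a version of the conditional expectation E[X | G]. *)
Definition is_cond_expectation (R : realType) (disp : measure_display)
    (Omega : measurableType disp) (P : probability Omega R)
    (G : set (set Omega)) (X Y : Omega -> R) : Prop :=
  [/\ measurable_wrt G Y,
      P.-integrable [set: Omega] (EFin \o Y) &
      forall A, G A ->
        (\int[P]_(w in A) (Y w)%:E = \int[P]_(w in A) (X w)%:E)%E].

Definition martingale (R : realType) (disp : measure_display)
    (Omega : measurableType disp) (P : probability Omega R)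
    (F : nat -> set (set Omega)) (X : nat -> Omega -> R) : Prop :=
  [/\ (forall n, measurable_wrt (F n) (X n)),
      (forall n, P.-integrable [set: Omega] (EFin \o X n)) &
      (forall m n, (m <= n)%N -> is_cond_expectation P (F m) (X n) (X m))].

(* Main.v *)
Require Import Defs.
From HB Require Import structures.
From mathcomp Require Import all_boot all_order all_algebra.
From mathcomp Require Import all_classical all_reals all_analysis.
From mathcomp Require Import measurable_realfun.
From mathcomp Require Import ring.

Import Order.TTheory GRing.Theory Num.Theory.
Import numFieldNormedType.Exports.

Local Open Scope classical_set_scope.
Local Open Scope ring_scope.

Set Implicit Arguments.
Unset Strict Implicit.
Unset Printing Implicit Defensive.

(** Fix a sequence [g] that is dense in [E].  Every value [xi n (g i)] and every
    normalized increment [(xi n (g i) - xi n (g j)) / theta |g i - g j|] is a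
    martingale in [n], and all of them are dominated in absolute value by the
    single random variable [M n], whose expectation is bounded in [n].

    Two facts about martingales do the probabilistic work.  The first is a
    maximal inequality for a countable family of martingales with a common
    dominating process ([maximal_inequality]); applied to the increments it
    says that almost surely there is one constant [K], valid for all times at
    once, such that every [xi n] satisfies the modulus of continuity
    [K * theta] along [g].  The second is the almost sure convergence of
    martingales bounded in L1 ([martingale_ae_cvg]), obtained from the
    upcrossing inequality and the Borel-Cantelli lemma; it gives the
    convergence of [xi n (g i)] for all [i] outside one null set.

    The rest is deterministic.  Since each single [xi n] is continuous on [E],
    the bound [K * theta] passes from the dense sequence to all of [E]
    ([modulus_bound_dense]).  A sequence of functions with a common modulus of
    continuity that converges on a dense set converges everywhere
    ([equicontinuous_cvg]), and the limit inherits the bound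
    ([modulus_bound_lim]).  The limit field is defined as an upper limit, so
    that it is measurable for every [x], including on the exceptional null
    set. *)

(** * Upcrossings of a real sequence *)

Section upcrossing_pathwise.
Context {R : realType}.
Implicit Types (u : nat -> R) (c : R).

(** The buy-low, sell-high strategy at the levels [0] and [c]: one share is
    held after time [n] if it was bought below [0] and the price has not
    exceeded [c] since.  Each index with [sells] completes an upcrossing of
    [[0, c]]. *)
Fixpoint holding c u n : bool :=
  if n is m.+1 then
    if holding c u m then u n <= c else u n < 0
  else u 0 < 0.

Definition sells c u n := holding c u n && ~~ holding c u n.+1.

Lemma sells_infinitely_often c u : 0 < c ->
  (forall n, exists2 m, (n <= m)%N & u m < 0) ->
  (forall n, exists2 m, (n <= m)%N & c < u m) ->
  forall n, exists2 m, (n <= m)%N & sells c u m.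
Proof.
move=> c0 low high n.
have [m nm hm] : exists2 m, (n <= m)%N & holding c u m.
  have [[//|m] nm um] := low n.+1.
  have [hm|nhm] := boolP (holding c u m); first by exists m.
  by exists m.+1; [exact: ltnW|rewrite /= (negbTE nhm)].
apply: contrapT => nosell.
have hold k : (m <= k)%N -> holding c u k.
  elim: k => [|k IH]; first by rewrite leqn0 => /eqP <-.
  rewrite leq_eqVlt => /predU1P[<-//|]; rewrite ltnS => mk.
  apply: contrapT => /negP nhk; apply: nosell; exists k.
    exact: leq_trans mk.
  by rewrite /sells (IH mk).
have [[//|k] mk uk] := high m.+1.
by have := hold _ (ltnW mk); rewrite /= (hold _ mk) leNgt uk.
Qed.

(** The limit is the supremum of the levels exceeded infinitely often, that
    is, the upper limit of the sequence. *)
Lemma bounded_nonoscillating_cvg u K : (forall n, `|u n| <= K) ->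
  (forall a b : R, a < b -> ~ ((forall n, exists2 m, (n <= m)%N & u m < a) /\
                               (forall n, exists2 m, (n <= m)%N & b < u m))) ->
  cvgn u.
Proof.
move=> uK noosc.
pose S := [set q : R | forall n, exists2 m, (n <= m)%N & q < u m].
have SK : S (- K - 1).
  move=> n; exists n => //; have := uK n; rewrite ler_norml => /andP[+ _].
  by apply: lt_le_trans; rewrite ltrBlDr ltrDl.
have KS : ubound S K.
  move=> q /(_ 0%N)[m _ /ltW qm]; apply: le_trans qm _.
  by have := uK m; rewrite ler_norml => /andP[].
have supS : has_sup S by split; [exists (- K - 1)|exists K].
have below (P : nat -> Prop) : ~ (forall n, exists2 m, (n <= m)%N & ~ P m) ->
    \forall n \near \oo, P n.
  move=> /existsNP[n nP]; exists n => // m /= nm.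
  by apply: contrapT => nPm; apply: nP; exists m.
apply/cvg_ex; exists (sup S); apply/cvgrPdist_le => e e0.
have e20 : 0 < e / 2 by rewrite divr_gt0.
near=> n; rewrite ler_distlC; apply/andP; split.
  near: n; apply: below => osc.
  have [q Sq lq] := sup_adherent e20 supS.
  apply: (noosc (sup S - e) (sup S - e / 2)).
    by rewrite ltrD2l ltrN2 ltr_pdivrMr// ltr_pMr// ltr1n.
  split=> k.
    by have [m km] := osc k; exists m => //; rewrite ltNge; exact/negP.
  by have [m km qm] := Sq k; exists m => //; exact: lt_trans qm.
near: n; apply: below => osc.
have : sup S + e / 2 <= sup S.
  apply: sup_upper_bound => // k; have [m km] := osc k.
  exists m => //; apply: (@lt_le_trans _ _ (sup S + e)).
    by rewrite ltrD2l ltr_pdivrMr// ltr_pMr// ltr1n.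
  by apply/ltW; rewrite ltNge; exact/negP.
by rewrite gerDl leNgt e20.
Unshelve. all: by end_near. Qed.

End upcrossing_pathwise.

(** * Martingales and conditional expectations *)

(** The members of a sigma-algebra given as a set of sets are the measurable
    sets of the type that it generates; this makes the closure lemmas for
    measurable sets and functions available at each time of a filtration. *)
Lemma sigma_algebra_measurableE disp (T : measurableType disp)
    (G : set (set T)) :
  sigma_algebra setT G ->
  @measurable _ (g_sigma_algebraType G) = G.
Proof. exact: sigma_algebra_id. Qed.

Lemma measurable_wrtP (R : realType) disp (Omega : measurableType disp)
    (G : set (set Omega)) (X : Omega -> R) : sigma_algebra setT G ->
  measurable_wrt G X <->
  measurable_fun setT (X : g_sigma_algebraType G -> R).
Proof.
move=> sG; have mG := sigma_algebra_measurableE sG.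
split => [mX _ B mB|mX B mB].
  by rewrite setTI mG; exact: mX.
by rewrite -mG -[_ @^-1` _]setTI; exact: mX.
Qed.

Section martingale_theory.
Context {R : realType} {disp : measure_display} {Omega : measurableType disp}.
Variables (P : probability Omega R) (F : nat -> set (set Omega)).
Hypothesis filF : filtration F.

Let salgF n : sigma_algebra setT (F n). Proof. by case: filF. Qed.

Let measurableF n A : F n A -> measurable A.
Proof. by case: filF => _ + _; exact. Qed.

Lemma martingale_cst a : martingale P F (fun _ _ => a).
Proof.
have adap n : measurable_wrt (F n) (fun _ : Omega => a).
  by apply/measurable_wrtP => //; exact: measurable_cst.
have int : P.-integrable setT (EFin \o (fun _ : Omega => a)).
  exact: finite_measure_integrable_cst.
by split.
Qed.

Lemma martingaleB X Y : martingale P F X -> martingale P F Y ->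
  martingale P F (fun n => X n \- Y n).
Proof.
move=> [aX iX cX] [aY iY cY].
have adap n : measurable_wrt (F n) (X n \- Y n).
  by apply/measurable_wrtP => //; apply: measurable_funB;
    exact/measurable_wrtP.
have int n : P.-integrable setT (EFin \o (X n \- Y n)).
  have -> : EFin \o (X n \- Y n) = ((EFin \o X n) \- (EFin \o Y n))%E by [].
 
  exact: integrableB.
split=> // m n mn; split => // A FA.
have mA := measurableF FA.
have iS Z : P.-integrable setT Z -> P.-integrable A Z by exact: integrableS.
have BE k : (\int[P]_(w in A) ((X k \- Y k) w)%:E =
    \int[P]_(w in A) (X k w)%:E - \int[P]_(w in A) (Y k w)%:E)%E.
  by rewrite -(integralB mA (iS _ (iX k)) (iS _ (iY k))).
rewrite !BE; case: (cX _ _ mn) => _ _ ->//; by case: (cY _ _ mn) => _ _ ->.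
Qed.

Lemma martingaleZ c X : martingale P F X ->
  martingale P F (fun n => c \*o X n).
Proof.
move=> [aX iX cX].
have adap n : measurable_wrt (F n) (c \*o X n).
  by apply/measurable_wrtP => //; apply: measurable_funM => //;
    exact/measurable_wrtP.
have int n : P.-integrable setT (EFin \o (c \*o X n)).
  have -> : EFin \o (c \*o X n) = (fun w => c%:E * (EFin \o X n) w)%E by [].
  exact: integrableZl.
split=> // m n mn; split => // A FA.
have mA := measurableF FA.
have iS Z : P.-integrable setT Z -> P.-integrable A Z by exact: integrableS.
have ZE k : (\int[P]_(w in A) ((c \*o X k) w)%:E =
    c%:E * \int[P]_(w in A) (X k w)%:E)%E.
  by rewrite -(integralZl mA (iS _ (iX k))).
by rewrite !ZE; case: (cX _ _ mn) => _ _ ->.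
Qed.

Lemma martingale_measurable X n : martingale P F X ->
  measurable_fun setT (X n).
Proof.
move=> [aX _ _] _ B mB; rewrite setTI; exact: measurableF (aX _ _ mB).
Qed.

(** Split [A] according to the sign of [X k], which is known at time [k]: on
    each piece the martingale identity applies without absolute values. *)
Lemma martingale_abs_le X k n A : martingale P F X -> (k <= n)%N -> F k A ->
  (\int[P]_(w in A) `|X k w|%:E <= \int[P]_(w in A) `|X n w|%:E)%E.
Proof.
move=> mX kn FA; have [aX iX cX] := mX.
have mXk m := martingale_measurable m mX.
pose S := X k @^-1` `[0, +oo[.
have FS : F k S by apply: aX; exact: measurable_itv.
have sgF := sigma_algebra_measurableE (salgF k).
have FAS : F k (A `&` S) by rewrite -sgF; apply: measurableI; rewrite sgF.
have FAD : F k (A `\` S) by rewrite -sgF; apply: measurableD; rewrite sgF.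
have mabs m B : measurable_fun B (fun w => `|X m w|%:E).
  apply: measurable_funTS; apply/measurable_EFinP.
  exact: measurableT_comp.
have split_int m : (\int[P]_(w in A) `|X m w|%:E =
    \int[P]_(w in A `&` S) `|X m w|%:E + \int[P]_(w in A `\` S) `|X m w|%:E)%E.
  rewrite -ge0_integral_setU ?setUIDK//;
    [exact: measurableF FAS|exact: measurableF FAD|].
  by apply/eqP/seteqP; split => // w [[_ +] [_]].
have piece B : F k B ->
    (`|\int[P]_(w in B) (X k w)%:E| <= \int[P]_(w in B) `|X n w|%:E)%E.
  move=> FB; case: (cX _ _ kn) => _ _ ->//.
  apply: le_abse_integral; first exact: measurableF FB.
  by apply: measurable_funTS; exact/measurable_EFinP.
rewrite !split_int; apply: leeD.
  apply: le_trans (piece _ FAS); rewrite (@eq_integral _ _ _ _ _ (EFin \o X k)).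
    exact: lee_abs.
  by move=> w; rewrite inE /S/= in_itv/= andbT => -[_ /ger0_norm ->].
apply: le_trans (piece _ FAD).
have -> : (\int[P]_(w in A `\` S) `|X k w|%:E =
    - \int[P]_(w in A `\` S) (X k w)%:E)%E; last by rewrite -abseN lee_abs.
rewrite -integralN.
  apply: eq_integral => w; rewrite inE /S/= in_itv/= andbT => -[_ /negP].
  by rewrite -ltNge => /ltr0_norm ->.
apply: integrable_add_def; first exact: measurableF FAD.
by apply: integrableS (iX k) => //; exact: measurableF FAD.
Qed.

(** * Maximal inequality for a countable family of martingales *)

Section maximal.
Variables (Z : nat -> nat -> Omega -> R) (N : nat -> Omega -> \bar R).
Hypothesis martZ : forall j, martingale P F (Z j).
Hypothesis mN : forall n, measurable_fun setT (N n).
Hypothesis ZN : forall j n w, (`|Z j n w|%:E <= N n w)%E.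

Let N_ge0 n w : (0 <= N n w)%E.
Proof. exact: le_trans (ZN 0 n w). Qed.

Let exceed (lambda : R) k j := [set w | lambda < `|Z j k w|].

Let F_exceed lambda k j : F k (exceed lambda k j).
Proof.
have [aZ _ _] := martZ j.
have -> : exceed lambda k j =
    Z j k @^-1` (setT `&` (@Num.norm R R) @^-1` `]lambda, +oo[).
  by apply/seteqP; split => w; rewrite /exceed/= in_itv/= andbT; tauto.
by apply: aZ; exact: normr_measurable.
Qed.

Lemma level_set_le j k n (lambda : R) A : 0 <= lambda -> (k <= n)%N -> F k A ->
  A `<=` [set w | lambda < `|Z j k w|] ->
  (lambda%:E * P A <= \int[P]_(w in A) N n w)%E.
Proof.
move=> l0 kn FA AZ; have mA := measurableF FA.
have mabs m : measurable_fun A (fun w => `|Z j m w|%:E).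
  apply: measurable_funTS; apply/measurable_EFinP.
  by apply: measurableT_comp => //; exact: martingale_measurable (martZ j).
rewrite -integral_cst//.
apply: (@le_trans _ _ (\int[P]_(w in A) `|Z j k w|%:E)%E).
  apply: ge0_le_integral => //= w Aw.
  by rewrite lee_fin ltW// AZ.
apply: le_trans (martingale_abs_le (martZ j) kn FA) _.
by apply: ge0_le_integral => //= *; exact: measurable_funTS.
Qed.

(** Split [A] according to the first index [j] whose martingale exceeds
    [lambda] at time [k].  This replaces the submartingale property of the
    supremum of the family. *)
Lemma level_set_bigcup_le k n (lambda : R) A :
  0 <= lambda -> (k <= n)%N -> F k A ->
  A `<=` \bigcup_j [set w | lambda < `|Z j k w|] ->
  (lambda%:E * P A <= \int[P]_(w in A) N n w)%E.
Proof.
move=> l0 kn FA AZ; have mA := measurableF FA.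
have sgF := sigma_algebra_measurableE (salgF k).
pose B j := A `&` seqDU (exceed lambda k) j.
have FB j : F k (B j).
  rewrite -sgF; apply: measurableI; first by rewrite sgF.
  apply: measurableD; first by rewrite sgF; exact: F_exceed.
  by apply: bigsetU_measurable => i _; rewrite sgF; exact: F_exceed.
have AE : A = \bigcup_j B j.
  rewrite -setI_bigcupr -seqDU_bigcup_eq; apply/esym/setIidPl.
  exact: AZ.
have tB : trivIset setT B.
  by apply: trivIset_setIl; exact: trivIset_seqDU.
have mB j : measurable (B j) by exact: measurableF (FB j).
rewrite [in leRHS]AE ge0_integral_bigcup//; last first.
  by rewrite -AE; exact: measurable_funTS.
rewrite [in leLHS]AE measure_semi_bigcup//; last exact: bigcupT_measurable.
rewrite -nneseriesZl//; apply: lee_nneseries => [j _ _|j _].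
  by rewrite mule_ge0// lee_fin.
apply: level_set_le (FB j) _ => // w [_]; exact: subset_seqDU.
Qed.

(** Split the event according to the first time [k] at which some member of
    the family exceeds [lambda].  Up to time [n], the bounds for these disjoint
    events add up to at most the expectation of [N n]. *)
Lemma maximal_inequality (lambda : R) C : 0 <= lambda ->
  (forall n, \int[P]_w N n w <= C)%E ->
  (lambda%:E *
    P (\bigcup_k \bigcup_j [set w | (lambda < `|Z j k w|)%R]) <= C)%E.
Proof.
move=> l0 NC.
pose B k := \bigcup_j exceed lambda k j.
have FB k : F k (B k).
  rewrite -(sigma_algebra_measurableE (salgF k)).
  apply: bigcupT_measurable => j.
  by rewrite (sigma_algebra_measurableE (salgF k)); exact: F_exceed.
have FA k : F k (seqDU B k).
  rewrite -(sigma_algebra_measurableE (salgF k)).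
  apply: measurableD; first by rewrite sigma_algebra_measurableE.
  apply: bigsetU_measurable => i _; rewrite sigma_algebra_measurableE//.
  by case: filF => _ _; apply; [exact: ltnW (ltn_ord i)|exact: FB].
have mA k : measurable (seqDU B k) by exact: measurableF (FA k).
rewrite -[X in P X]/(\bigcup_k B k) seqDU_bigcup_eq measure_semi_bigcup//;
  last exact: bigcupT_measurable.
rewrite -nneseriesZl//; apply: lime_le.
  by apply: is_cvg_nneseries => k _ _; rewrite mule_ge0// lee_fin.
apply: nearW => n; apply: le_trans (NC n).
apply: (@le_trans _ _ (\sum_(0 <= k < n) \int[P]_(w in seqDU B k) N n w)%E).
  rewrite !big_nat; apply: lee_sum => k /= kn.
  apply: level_set_bigcup_le (FA k) _ => //; first exact: ltnW.
  exact: subset_seqDU.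
rewrite -ge0_integral_bigsetU//; first last.
- exact: measurable_funTS.
- exact: sub_trivIset (@trivIset_seqDU _ B).
- exact: iota_uniq.
apply: ge0_subset_integral => //.
by apply: bigsetU_measurable.
Qed.

(** The family is unbounded only on an event that the maximal inequality
    bounds by [C / l] for every [l]. *)
Lemma ae_bounded_martingales C : (C < +oo)%E ->
  (forall n, \int[P]_w N n w <= C)%E ->
  {ae P, forall w, exists K, forall j n, `|Z j n w| <= K}.
Proof.
move=> Coo NC.
pose A l := \bigcup_k \bigcup_j [set w | l%:R < `|Z j k w|].
have mA l : measurable (A l).
  apply: bigcupT_measurable => k; apply: bigcupT_measurable => j.
  exact: measurableF (F_exceed l%:R k j).
have mI : measurable (\bigcap_l A l) by exact: bigcapT_measurable.
have C0 : (0 <= C)%E.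
  by apply: le_trans (NC 0); apply: integral_ge0.
have Cfin : C \is a fin_num by rewrite ge0_fin_numE.
exists (\bigcap_l A l); split => //.
  apply/eqP; rewrite eq_le measure_ge0 andbT.
  apply/lee_addgt0Pr => e e0; rewrite add0e.
  have [l Cl] : exists l : nat, fine C / e <= l%:R.
    exists (Num.bound (fine C / e)); apply/ltW/archi_boundP.
    by apply: divr_ge0; [exact: fine_ge0|exact: ltW].
  have l0 : 0 < l.+1%:R :> R by rewrite ltr0n.
  have PA : (P (A l.+1) <= e%:E)%E.
    have := maximal_inequality (ltW l0) NC.
    rewrite -/(A _) -(fineK Cfin) -(@fineK _ (P (A l.+1))); last first.
      exact: fin_num_measure.
    rewrite -EFinM !lee_fin => h; rewrite -(ler_pM2l l0).
    apply: le_trans h _; rewrite -ler_pdivrMr//; apply: le_trans Cl _.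
    by rewrite ler_nat.
  apply: le_trans PA; apply: le_measure; rewrite ?inE//.
  exact: bigcap_inf.
move=> w /= noK l _; apply: contrapT => nA; apply: noK; exists l%:R => j n.
by rewrite leNgt; apply/negP => lt; apply: nA; exists n => //; exists j.
Qed.

End maximal.

(** * Almost sure convergence of martingales bounded in L1 *)

Section upcrossing.
Variables (Y : nat -> Omega -> R) (c : R).
Hypotheses (mY : martingale P F Y) (c0 : 0 < c).

Let H n := [set w | holding c (Y ^~ w) n].
Let D n := [set w | sells c (Y ^~ w) n].

Lemma adapted_holding n : F n [set w | holding c (Y ^~ w) n].
Proof.
have [aY _ _] := mY; have sg k := sigma_algebra_measurableE (salgF k).
have low k : F k (Y k @^-1` `]-oo, 0[) by apply: aY; exact: measurable_itv.
rewrite -/(H n); elim: n => [|n IH].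
  have -> // : H 0 = Y 0 @^-1` `]-oo, 0[.
  by apply/seteqP; split => w; rewrite /H/= in_itv.
have -> : H n.+1 = (H n `&` Y n.+1 @^-1` `]-oo, c]) `|`
    (~` H n `&` Y n.+1 @^-1` `]-oo, 0[).
  apply/seteqP; split => w; rewrite /H/= !in_itv/=.
    by case: (holding _ _ n) => ?; [left|right].
  by case=> -[]; [move=> ->|move=> /negP/negbTE ->].
have FH : F n.+1 (H n) by case: filF => _ _; apply; [exact: leqnSn|exact: IH].
rewrite -sg; apply: measurableU; apply: measurableI; rewrite ?sg//.
- by apply: aY; exact: measurable_itv.
- by rewrite -sg; apply: measurableC; rewrite sg.
Qed.

Let mH n : measurable (H n). Proof. exact: measurableF (adapted_holding n). Qed.

Lemma measurable_sells n : measurable [set w | sells c (Y ^~ w) n].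
Proof.
have -> : [set w | sells c (Y ^~ w) n] = H n `\` H n.+1.
  by apply/seteqP; split => w; rewrite /H/sells/=; [move=> /andP[-> /negP]|
    move=> [-> /negP ->]].
exact: measurableD.
Qed.

(** The expected gain of the strategy is zero, and it is at least [c] for each
    completed upcrossing plus the price of the share still held.  By induction
    on [n], without introducing the gain process: passing from [n] to [n.+1],
    the integral over [H n] is unchanged by the martingale property, the part
    of [H n] that sells contributes at least [c] times its probability, and the
    part that newly buys has a negative price. *)
Lemma upcrossing_gain n :
  c * \sum_(k < n) fine (P [set w | sells c (Y ^~ w) k]) +
  \int[P]_(w in [set w | holding c (Y ^~ w) n]) Y n w <= 0.
Proof.
have [_ iY cY] := mY.
have iA k A : measurable A -> P.-integrable A (EFin \o Y k).
  by move=> mA; apply: integrableS (iY k).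
have i0 A : measurable A -> P.-integrable A (EFin \o cst (0 : R)).
  by move=> mA; exact: finite_measure_integrable_cst.
have neg A k : measurable A -> (forall w, A w -> Y k w < 0) ->
    \int[P]_(w in A) Y k w <= 0.
  move=> mA A0; rewrite -[leRHS](mul0r (fine (P A))) -Rintegral_cst//.
  apply: le_Rintegral => //; [exact: iA|exact: i0|].
  by move=> w Aw; apply/ltW/A0.
rewrite -/(H n); elim: n => [|n IH].
  by rewrite big_ord0 mulr0 add0r; apply: neg.
apply: le_trans IH; rewrite big_ord_recr/= mulrDr -addrA lerD2l -/(D n).
have mD : measurable (D n) := measurable_sells n.
have mI : measurable (H n `&` H n.+1) by exact: measurableI.
have mB : measurable (H n.+1 `\` H n) by exact: measurableD.
have -> : \int[P]_(w in H n) Y n w = \int[P]_(w in H n) Y n.+1 w.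
  have [_ _ E] := cY _ _ (leqnSn n).
  by rewrite /Rintegral E//; exact: adapted_holding.
have HnE : H n = D n `|` (H n `&` H n.+1).
  apply/seteqP; split => w; last by move=> [/andP[]|[]].
  move=> Hw; have [HSw|nHSw] := boolP (holding c (Y ^~ w) n.+1).
    by right; split.
  by left; apply/andP.
have HSE : H n.+1 = (H n.+1 `\` H n) `|` (H n `&` H n.+1).
  by rewrite setIC setUC setUIDK.
rewrite [in leRHS]HnE [X in _ + Rintegral _ X _]HSE.
rewrite !Rintegral_setU//; first last.
- by apply/eqP; apply/seteqP; split => // w [[_ nH] [/nH]].
- by rewrite -HSE; exact: iA.
- by apply/eqP; apply/seteqP; split => // w [/andP[_ /negP nS] [_ /nS]].
- by rewrite -HnE; exact: iA.
rewrite addrA lerD2r -[leRHS]addr0; apply: lerD.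
  rewrite -Rintegral_cst//; apply: le_Rintegral => //.
  - exact: finite_measure_integrable_cst.
  - exact: iA.
  - by move=> w; rewrite /D/sells/= => /andP[-> ]; rewrite -ltNge => /ltW.
apply: neg => // w; rewrite /H/= => -[+ /negP/negbTE hn].
by rewrite hn.
Qed.

Lemma upcrossing_inequality n :
  (c%:E * \sum_(k < n) P [set w | sells c (Y ^~ w) k] <=
   \int[P]_w `|Y n w|%:E)%E.
Proof.
have [_ iY cY] := mY.
have iabs : P.-integrable setT (EFin \o (fun w => `|Y n w|)).
  exact: integrable_norm.
have iabsH : P.-integrable (H n) (EFin \o (fun w => `|Y n w|)).
  exact: integrableS iabs.
have iH : P.-integrable (H n) (EFin \o Y n) by exact: integrableS (iY n).
rewrite -(@fineK _ (\int[P]_w _)%E); last exact: integrable_fin_num.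
rewrite -/(Rintegral P setT (fun w => `|Y n w|)).
rewrite (eq_bigr (fun k : 'I_n => (fine (P (D k)))%:E)); last first.
  by move=> k _; rewrite fineK// fin_num_measure//; exact: measurable_sells.
rewrite sumEFin -EFinM lee_fin.
have := upcrossing_gain n; rewrite -lerBrDr add0r => /le_trans; apply.
apply: (@le_trans _ _ (\int[P]_(w in H n) `|Y n w|)).
  apply: le_trans (le_normr_Rintegral _ _) => //.
  by rewrite -normrN ler_norm.
rewrite fine_le//; try exact: integrable_fin_num.
apply: ge0_subset_integral => //.
by apply/measurable_EFinP; case/integrableP: iabs => /measurable_EFinP.
Qed.

(** The probabilities of selling at time [n] are summable, so this is the
    Borel-Cantelli lemma. *)
Lemma ae_finitely_many_sells C : (C < +oo)%E ->
  (forall n, \int[P]_w `|Y n w|%:E <= C)%E ->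
  {ae P, forall w, ~ forall n, exists2 m, (n <= m)%N & sells c (Y ^~ w) m}.
Proof.
move=> Coo YC.
have C0 : (0 <= C)%E by apply: le_trans (YC 0); apply: integral_ge0.
have Cfin : C \is a fin_num by rewrite ge0_fin_numE.
have limD : P (lim_sup_set D) = 0.
  apply: lim_sup_set_cvg0 => [k|]; first exact: measurable_sells.
  apply: (@le_lt_trans _ _ (c^-1 * fine C)%:E); last exact: ltry.
  apply: lime_le; first by apply: is_cvg_nneseries.
  apply: nearW => n; rewrite big_mkord EFinM lee_pdivlMl// fineK//.
  exact: le_trans (upcrossing_inequality n) (YC n).
exists (lim_sup_set D); split => //.
  apply: bigcapT_measurable => n; apply: bigcup_measurable => k _.
  exact: measurable_sells.
move=> w /= /contrapT sell n _; have [m nm Dm] := sell n; by exists m.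
Qed.

End upcrossing.

(** Doob's convergence theorem.  Applied to [X - a] with [c = b - a] for all
    rational [a < b], the upcrossing bound excludes oscillation outside one null
    set; the maximal inequality for the one-member family [X] excludes
    divergence to infinity. *)
Lemma martingale_ae_cvg X C : martingale P F X -> (C < +oo)%E ->
  (forall n, \int[P]_w `|X n w|%:E <= C)%E ->
  {ae P, forall w, cvgn (X ^~ w)}.
Proof.
move=> mX Coo XC; have [_ iX _] := mX.
have mXn n := martingale_measurable n mX.
have bounded : {ae P, forall w, exists K, forall n, `|X n w| <= K}.
  have : {ae P, forall w, exists K, forall j n : nat, `|X n w| <= K}.
    apply: (@ae_bounded_martingales (fun=> X)
      (fun n w => `|X n w|%:E) _ _ _ C) => //.
    by move=> n; apply/measurable_EFinP; exact: measurableT_comp.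
  by apply: filterS => w [K XK]; exists K => n; exact: XK 0%N n.
(* An enumeration of the pairs of rational levels. *)
pose thr (p : nat) : R * R :=
  let: (q, r) := odflt (0, 0) (unpickle p) : rat * rat in (ratr q, ratr r).
have nosell : {ae P, forall w, forall p : nat, let: (a, b) := thr p in a < b ->
    ~ forall n, exists2 m, (n <= m)%N & sells (b - a) (fun k => X k w - a) m}.
  apply: ae_foralln => p; case: (thr p) => a b.
  have [ab|ba] := ltP a b; last by apply: aeW.
  have ba0 : 0 < b - a by rewrite subr_gt0.
  have mY := martingaleB mX (martingale_cst a).
  suff : {ae P, forall w, ~ forall n, exists2 m, (n <= m)%N &
      sells (b - a) (fun k => X k w - a) m} by apply: filterS.
  apply: (@ae_finitely_many_sells _ _ mY ba0 (C + `|a|%:E)%E).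
    by rewrite lte_add_pinfty// ltry.
  move=> n; apply: (@le_trans _ _ (\int[P]_w (`|X n w|%:E + `|a|%:E))%E).
    apply: ge0_le_integral => //=.
    - apply/measurable_EFinP; apply: measurableT_comp => //.
      exact: measurable_funB.
    - apply: emeasurable_funD => //; apply/measurable_EFinP.
      exact: measurableT_comp.
    - by move=> w _; rewrite -EFinD lee_fin ler_normB.
  rewrite ge0_integralD//; last first.
    by apply/measurable_EFinP; exact: measurableT_comp.
  apply: leeD => //; rewrite integral_cst//= probability_setT.
  by rewrite mule1.
apply: filterS2 bounded nosell => w [K XK] ns.
apply: (bounded_nonoscillating_cvg XK) => a b ab [lo hi].
have [q] := rat_in_itvoo ab; rewrite in_itv/= => /andP[aq qb].
have [r] := rat_in_itvoo qb; rewrite in_itv/= => /andP[qr rb].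
have := ns (pickle (q, r)); rewrite /thr pickleK/= => /(_ qr); apply.
apply: sells_infinitely_often; first by rewrite subr_gt0.
  move=> n; have [m nm lt] := lo n; exists m => //.
  by rewrite subr_lt0; exact: lt_trans lt aq.
move=> n; have [m nm lt] := hi n; exists m => //.
by rewrite ltrD2r; exact: lt_trans rb lt.
Qed.

End martingale_theory.

(** * Domination by a nonmeasurable process *)

(** The integral of a nonnegative function is a supremum over the simple
    functions below it, hence monotone even without measurability.  This is
    what allows to work with [M n], a supremum over uncountably many points. *)
Lemma ge0_le_integral_nonmeasurable (R : realType) disp
    (Omega : measurableType disp) (mu : {measure set Omega -> \bar R})
    (f g : Omega -> \bar R) : (forall w, 0 <= f w)%E ->
  (forall w, f w <= g w)%E -> (\int[mu]_w f w <= \int[mu]_w g w)%E.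
Proof.
move=> f0 fg; rewrite !ge0_integralTE// => [|w]; last exact: le_trans (fg w).
apply: ereal_sup_le => _ [h hf <-]; exists h => // w.
exact: le_trans (hf w) (fg w).
Qed.

(** A form of [ae_bounded_martingales] with an arbitrary dominating process:
    the supremum of the countable family is measurable and lies below it. *)
Lemma ae_bounded_dominated_martingales (R : realType) disp
    (Omega : measurableType disp) (P : probability Omega R)
    (F : nat -> set (set Omega)) (Z : nat -> nat -> Omega -> R)
    (M : nat -> Omega -> \bar R) : filtration F ->
  (forall j, martingale P F (Z j)) ->
  (forall j n w, `|Z j n w|%:E <= M n w)%E ->
  (ereal_sup (range (fun n => \int[P]_w M n w)) < +oo)%E ->
  {ae P, forall w, exists K, forall j n, `|Z j n w| <= K}.
Proof.
move=> filF mZ ZM Moo.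
pose N n w := esups (fun j => `|Z j n w|%:E) 0%N.
have ZN j n w : (`|Z j n w|%:E <= N n w)%E.
  by apply: ereal_sup_ubound; exists j.
have NM n w : (N n w <= M n w)%E.
  by apply: ge_ereal_sup => _ [j _ <-]; exact: ZM.
have mN n : measurable_fun setT (N n).
  apply: measurable_fun_esups => j; apply/measurable_EFinP.
  apply: measurableT_comp => //. exact (martingale_measurable filF n (mZ j)).
apply: (ae_bounded_martingales filF mZ mN ZN Moo) => n.
apply: (@le_trans _ _ (\int[P]_w M n w)%E); last first.
  by apply: ereal_sup_ubound; exists n.
apply: ge0_le_integral_nonmeasurable => // w.
exact: le_trans (ZN 0%N n w).
Qed.

(** * Euclidean norm and dense sequences *)

Section euclidean_norm.
Context {R : realType} {d : nat}.
Implicit Types x y z : 'rV[R]_d.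
Local Notation en := (@euclidean_norm R d).

Lemma euclidean_norm_ge0 x : 0 <= en x.
Proof. exact: sqrtr_ge0. Qed.

Lemma euclidean_norm0 : en 0 = 0.
Proof.
rewrite /euclidean_norm big1 ?sqrtr0// => i _.
by rewrite mxE expr0n.
Qed.

Lemma euclidean_normN x : en (- x) = en x.
Proof.
by rewrite /euclidean_norm; congr Num.sqrt; apply: eq_bigr => i _;
  rewrite mxE sqrrN.
Qed.

Lemma euclidean_distC x y : en (x - y) = en (y - x).
Proof. by rewrite -euclidean_normN opprB. Qed.

Lemma sqr_euclidean_norm x : en x ^+ 2 = \sum_(i < d) x ord0 i ^+ 2.
Proof. by rewrite sqr_sqrtr// sumr_ge0// => i _; exact: sqr_ge0. Qed.

Lemma euclidean_norm_eq0 x : en x = 0 -> x = 0.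
Proof.
move=> x0; have := sqr_euclidean_norm x; rewrite x0 expr0n/= => /esym/eqP.
rewrite psumr_eq0 => [/allP h|i _]; last exact: sqr_ge0.
apply/rowP => i; rewrite mxE; apply/eqP.
by have := h i (mem_index_enum _); rewrite sqrf_eq0.
Qed.

(** Expand the square in the nonnegative sum of [(|y| x_i - |x| y_i) ^ 2]. *)
Lemma cauchy_schwarz x y :
  \sum_(i < d) x ord0 i * y ord0 i <= en x * en y.
Proof.
have [/euclidean_norm_eq0 ->|x0] := eqVneq (en x) 0.
  by rewrite euclidean_norm0 mul0r big1// => i _; rewrite mxE mul0r.
have [/euclidean_norm_eq0 ->|y0] := eqVneq (en y) 0.
  by rewrite euclidean_norm0 mulr0 big1// => i _; rewrite mxE mulr0.
have xy0 : 0 < en x * en y.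
  by rewrite mulr_gt0// lt_neqAle eq_sym ?x0 ?y0 euclidean_norm_ge0.
have : 0 <= \sum_(i < d) (en y * x ord0 i - en x * y ord0 i) ^+ 2.
  by apply: sumr_ge0 => i _; exact: sqr_ge0.
have -> : \sum_(i < d) (en y * x ord0 i - en x * y ord0 i) ^+ 2 =
    2 * (en x * en y) * (en x * en y - \sum_(i < d) x ord0 i * y ord0 i).
  transitivity (en y ^+ 2 * (\sum_(i < d) x ord0 i ^+ 2)
      - 2 * (en x * en y) * (\sum_(i < d) x ord0 i * y ord0 i)
      + en x ^+ 2 * (\sum_(i < d) y ord0 i ^+ 2)).
    rewrite !mulr_sumr -sumrB -big_split/=; apply: eq_bigr => i _; ring.
  rewrite -!sqr_euclidean_norm; ring.
by rewrite pmulr_rge0 ?subr_ge0// mulr_gt0.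
Qed.

Lemma ler_euclidean_normD x y : en (x + y) <= en x + en y.
Proof.
rewrite -(@ler_pXn2r _ 2) ?nnegrE ?addr_ge0 ?euclidean_norm_ge0//.
rewrite sqrrD !sqr_euclidean_norm.
rewrite (eq_bigr (fun i => x ord0 i ^+ 2 + (x ord0 i * y ord0 i) *+ 2 +
    y ord0 i ^+ 2)); last by move=> i _; rewrite mxE sqrrD.
rewrite 2!big_split/= lerD2r lerD2l sumrMnl lerMn2r/=.
exact: cauchy_schwarz.
Qed.

Lemma euclidean_dist_triangle x y z : en (x - z) <= en (x - y) + en (y - z).
Proof. by rewrite -[x - z](subrKA y) ler_euclidean_normD. Qed.

(** A crude comparison with the sup norm, enough for density arguments. *)
Lemma euclidean_norm_le_coord x e : 0 <= e ->
  (forall i, `|x ord0 i| <= e) -> en x <= e * d%:R.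
Proof.
move=> e0 xe; rewrite -(@ler_pXn2r _ 2) ?nnegrE ?mulr_ge0 ?euclidean_norm_ge0//.
rewrite sqr_euclidean_norm; apply: (@le_trans _ _ (\sum_(i < d) e ^+ 2)).
  apply: ler_sum => i _; rewrite -real_normK ?num_real//.
  by rewrite ler_pXn2r ?nnegrE.
rewrite sumr_const card_ord -[leLHS]mulr_natr exprMn ler_wpM2l ?sqr_ge0//.
by rewrite -natrX ler_nat -mulnn; case: (d) => // k; exact: leq_pmulr.
Qed.

Lemma rational_dense x e : 0 < e ->
  exists q : 'rV[rat]_d, en (x - map_mx ratr q) < e.
Proof.
move=> e0; pose r := e / (d.+1)%:R.
have r0 : 0 < r by rewrite divr_gt0.
have [q xq] : exists q : 'rV[rat]_d,
    forall i, `|x ord0 i - ratr (q ord0 i)| <= r.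
  have near_x i : exists q : rat, `|x ord0 i - ratr q| <= r.
    have [|q] := @rat_in_itvoo R (x ord0 i - r) (x ord0 i + r).
      by rewrite ltrBlDr -addrA ltrDl addr_gt0.
    rewrite in_itv/= => /andP[xq qx]; exists q.
    by rewrite distrC ler_distl !ltW.
  exists (\row_i xchoose (near_x i)) => i.
  by rewrite mxE; exact: (xchooseP (near_x i)).
exists q; apply: (@le_lt_trans _ _ (r * d%:R)).
  by apply: euclidean_norm_le_coord => [|i]; [exact: ltW|rewrite !mxE].
by rewrite /r mulrAC ltr_pdivrMr// ltr_pM2l// ltr_nat.
Qed.

(** For each rational point and each [n], choose a point of [E] within
    [1 / n.+1] of it when there is one. *)
Lemma exists_dense_sequence (E : set 'rV[R]_d) : E !=set0 ->
  exists g : nat -> 'rV[R]_d, (forall i, E (g i)) /\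
    forall x e, E x -> 0 < e -> exists i, en (x - g i) < e.
Proof.
move=> [x0 Ex0].
pose near_q (p : 'rV[rat]_d * nat) :=
  E `&` [set y | en (y - map_mx ratr p.1) < (p.2.+1%:R)^-1].
pose h p := xget x0 (near_q p).
have Eh p : E (h p) by rewrite /h; case: xgetP => // y _ [].
exists (fun i => h (odflt (0, 0%N) (unpickle i))); split=> // x e Ex e0.
have e20 : 0 < e / 2 by rewrite divr_gt0.
pose n := Num.bound (e / 2)^-1.
have ne : (n.+1%:R)^-1 < e / 2.
  rewrite invf_plt ?posrE//.
  have := archi_boundP (ltW (_ : 0 < (e / 2)^-1)).
  by rewrite invr_gt0 => /(_ e20) /lt_trans; apply; rewrite ltr_nat.
have [q xq] : exists q : 'rV[rat]_d, en (x - map_mx ratr q) < (n.+1%:R)^-1.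
  exact: rational_dense.
exists (pickle (q, n)); rewrite pickleK/=.
have [_ hq] : near_q (q, n) (h (q, n)) by apply: (@xgetPex _ x0); exists x.
apply: le_lt_trans (euclidean_dist_triangle _ (map_mx ratr q) _) _.
rewrite (splitr e) ltrD//; first exact: lt_trans ne.
by rewrite euclidean_distC; exact: lt_trans ne.
Qed.

End euclidean_norm.

(** * Functions with a given modulus of continuity *)

Section modulus.
Context {R : realType} {d : nat}.
Variables (E : set 'rV[R]_d) (theta : R -> R).
Hypothesis modt : modulus_of_continuity theta.
Local Notation en := (@euclidean_norm R d).

Let theta_ge0 x : 0 <= theta (en x).
Proof. by case: modt => + _ _ _ _; apply; exact: euclidean_norm_ge0. Qed.

Definition modulus_bound K (f : 'rV[R]_d -> R) :=
  forall x y, E x -> E y -> `|f x - f y| <= K * theta (en (x - y)).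

(** When [theta] vanishes at the distance of two points, the quotient [a / 0] is
    infinite unless [a = 0], in agreement with the bound [K * 0]. *)
Lemma modulus_seminormP K f : 0 <= K ->
  (modulus_seminorm E theta f <= K%:E)%E <-> modulus_bound K f.
Proof.
move=> K0; split=> [fK x y Ex Ey|fK].
  have [<-|xy] := eqVneq x y; first by rewrite subrr normr0 mulr_ge0.
  have : (`|f x - f y|%:E / (theta (en (x - y)))%:E <= K%:E)%E.
    apply: le_trans fK; apply: ereal_sup_ubound; right.
    by exists x, y; split.
  rewrite inver; case: ifPn => [/eqP ->|t0].
    have [->|f0] := eqVneq `|f x - f y| 0; first by rewrite mulr0.
    by rewrite gt0_muley ?leye_eq// lte_fin lt0r f0 /=.
  by rewrite -EFinM lee_fin ler_pdivrMr// lt0r t0 theta_ge0.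
apply: ge_ereal_sup => _ [->|[x [y [Ex Ey xy ->]]]]; first by rewrite lee_fin.
rewrite inver; case: ifPn => [/eqP t0|t0].
  have := fK _ _ Ex Ey; rewrite t0 mulr0 normr_le0 => /eqP ->.
  by rewrite normr0 mul0e lee_fin.
by rewrite -EFinM lee_fin ler_pdivrMr ?fK// lt0r t0 theta_ge0.
Qed.

Lemma modulus_seminorm_ge0 f : (0 <= modulus_seminorm E theta f)%E.
Proof. by apply: ereal_sup_ubound; left. Qed.

Lemma sup_norm_ge0 f : (0 <= sup_norm E f)%E.
Proof. by apply: ereal_sup_ubound; left. Qed.

Lemma le_sup_norm f x : E x -> (`|f x|%:E <= sup_norm E f)%E.
Proof. by move=> Ex; apply: ereal_sup_ubound; right; exists x. Qed.

Lemma admits_modulusP f :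
  admits_modulus E theta f <-> exists2 K, 0 <= K & modulus_bound K f.
Proof.
split=> [fin|[K K0 /(modulus_seminormP _ K0) fK]]; last first.
  exact: le_lt_trans fK (ltry _).
have fE : modulus_seminorm E theta f \is a fin_num.
  by rewrite ge0_fin_numE// modulus_seminorm_ge0.
exists (fine (modulus_seminorm E theta f)).
  by rewrite fine_ge0// modulus_seminorm_ge0.
by apply/modulus_seminormP; rewrite ?fineK// fine_ge0// modulus_seminorm_ge0.
Qed.

(** With real inverses [0^-1 = 0], so the left-hand side degenerates to [0]
    where [theta] vanishes.  It is linear in [f], as needed to get a
    martingale. *)
Lemma increment_le_modulus_seminorm f x y : E x -> E y ->
  (`|(theta (en (x - y)))^-1 * (f x - f y)|%:E <= modulus_seminorm E theta f)%E.
Proof.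
move=> Ex Ey.
have [|Soo] := leP +oo%E (modulus_seminorm E theta f).
  by rewrite leye_eq => /eqP ->; exact: leey.
have Sfin : modulus_seminorm E theta f \is a fin_num.
  by rewrite ge0_fin_numE// modulus_seminorm_ge0.
have K0 : 0 <= fine (modulus_seminorm E theta f).
  by rewrite fine_ge0// modulus_seminorm_ge0.
have [+ _] := modulus_seminormP f K0; rewrite fineK// => /(_ (lexx _)) fK.
rewrite -[leRHS]fineK// lee_fin normrM mulrC normfV (ger0_norm (theta_ge0 _)).
have [t0|t0] := eqVneq (theta (en (x - y))) 0; first by rewrite t0 invr0 mulr0.
by rewrite ler_pdivrMr ?lt0r ?t0 ?theta_ge0// fK.
Qed.

Lemma modulus_small e : 0 < e ->
  exists2 r, 0 < r & forall t, 0 <= t -> t < r -> theta t < e.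
Proof.
case: modt => t_ge0 /continuous_within_itvcyP[_ ct] _ t0 _ e0.
move/cvgrPdist_lt: ct => /(_ _ e0); rewrite t0.
move=> [r /= r0 tr]; exists r => // t; rewrite le_eqVlt => /predU1P[<- _|tp lt].
  by rewrite t0.
have := tr t; rewrite /= sub0r normrN gtr0_norm// => /(_ lt tp).
by rewrite sub0r normrN ger0_norm// t_ge0// ltW.
Qed.

Variable g : nat -> 'rV[R]_d.
Hypotheses (Eg : forall i, E (g i))
  (dense_g : forall x e, E x -> 0 < e -> exists i, en (x - g i) < e).

(** The constant [L], which is not controlled, only provides the continuity
    of [f]: approximating [x] and [y] by points of the dense sequence costs
    [2 * (L + K) * theta s] with [s] arbitrarily small. *)
Lemma modulus_bound_dense f L K : 0 <= K -> modulus_bound L f ->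
  (forall i j, `|f (g i) - f (g j)| <= K * theta (en (g i - g j))) ->
  modulus_bound K f.
Proof.
case: modt => t_ge0 _ t_incr _ t_add K0 fL fK x y Ex Ey.
have L0 : 0 <= `|L| by [].
apply/ler_addgt0Pr => e e0.
pose r := e / (2 * (`|L| + K + 1)).
have S0 : 0 < `|L| + K + 1 by rewrite ltr_wpDl// addr_ge0.
have r0 : 0 < r by rewrite divr_gt0// mulr_gt0.
have [s s0 ts] := modulus_small r0.
have [i xi] := dense_g Ex s0; have [j yj] := dense_g Ey s0.
have txi : theta (en (x - g i)) <= r by rewrite ltW// ts// euclidean_norm_ge0.
have tyj : theta (en (y - g j)) <= r by rewrite ltW// ts// euclidean_norm_ge0.
have fx : `|f x - f (g i)| <= `|L| * r.
  apply: le_trans (fL _ _ Ex (Eg i)) _.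
  apply: (@le_trans _ _ (`|L| * theta (en (x - g i)))).
    by rewrite ler_wpM2r// ler_norm.
  by rewrite ler_wpM2l.
have fy : `|f y - f (g j)| <= `|L| * r.
  apply: le_trans (fL _ _ Ey (Eg j)) _.
  apply: (@le_trans _ _ (`|L| * theta (en (y - g j)))).
    by rewrite ler_wpM2r// ler_norm.
  by rewrite ler_wpM2l.
have fg : `|f (g i) - f (g j)| <= K * (theta (en (x - y)) + r + r).
  apply: le_trans (fK i j) _; rewrite ler_wpM2l//.
  apply: (@le_trans _ _ (theta (en (x - y) + en (x - g i) + en (y - g j)))).
    apply: t_incr; first exact: euclidean_norm_ge0.
    apply: le_trans (euclidean_dist_triangle _ y _) _.
    rewrite lerD2r [leRHS]addrC.
    apply: le_trans (euclidean_dist_triangle _ x _) _.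
    by rewrite lerD2r euclidean_distC.
  apply: le_trans (t_add _ _ _ _) _; rewrite ?addr_ge0 ?euclidean_norm_ge0//.
  rewrite lerD//; apply: le_trans (t_add _ _ _ _) _;
    by rewrite ?euclidean_norm_ge0// lerD.
have -> : f x - f y = (f x - f (g i)) + (f (g i) - f (g j)) - (f y - f (g j)).
  by ring.
apply: le_trans (ler_normB _ _) _.
apply: (@le_trans _ _ (`|L| * r + K * (theta (en (x - y)) + r + r) + `|L| * r)).
  by rewrite lerD//; apply: le_trans (ler_normD _ _) _; rewrite lerD.
have -> : `|L| * r + K * (theta (en (x - y)) + r + r) + `|L| * r =
   K * theta (en (x - y)) + 2 * (`|L| + K) * r by ring.
rewrite lerD2l /r mulrA ler_pdivrMr ?mulr_gt0// mulrC ler_pM2l//.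
by rewrite ler_pM2l// lerDl.
Qed.

Lemma equicontinuous_cvg (u : nat -> 'rV[R]_d -> R) K x : 0 <= K ->
  (forall n, modulus_bound K (u n)) -> (forall i, cvgn (u ^~ (g i))) ->
  E x -> cvgn (u ^~ x).
Proof.
move=> K0 uK ug Ex; apply/cauchy_cvgP/cauchyP => e e0.
pose r := e / (2 * (K + 1)).
have K10 : 0 < K + 1 by rewrite ltr_wpDl.
have r0 : 0 < r by rewrite divr_gt0// mulr_gt0.
have [s s0 ts] := modulus_small r0.
have [i xi] := dense_g Ex s0.
have txi : theta (en (x - g i)) <= r by rewrite ltW// ts// euclidean_norm_ge0.
have /cvg_ex[l ul] := ug i.
exists l; change (\forall n \near \oo, `|l - u n x| < e); near=> n.
have ln : `|l - u n (g i)| < e / 2.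
  near: n; move/cvgrPdist_lt: ul; apply; by rewrite divr_gt0.
have -> : l - u n x = (l - u n (g i)) - (u n x - u n (g i)) by ring.
apply: le_lt_trans (ler_normB _ _) _; rewrite (splitr e) ltr_leD//.
apply: le_trans (uK _ _ _ Ex (Eg i)) _.
apply: (@le_trans _ _ ((K + 1) * r)); first by rewrite ler_pM// lerDl.
by have -> // : (K + 1) * r = e / 2; rewrite /r; field; rewrite gt_eqF.
Unshelve. all: by end_near. Qed.

Lemma modulus_bound_lim (u : nat -> 'rV[R]_d -> R) f K :
  (forall n, modulus_bound K (u n)) ->
  (forall x, E x -> u n x @[n --> \oo] --> f x) -> modulus_bound K f.
Proof.
move=> uK uf x y Ex Ey.
have cv : `|u n x - u n y| @[n --> \oo] --> `|f x - f y|.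
  by apply: cvg_norm; apply: cvgB; exact: uf.
rewrite -(cvg_lim _ cv)//; apply: limr_le; first exact: cvgP cv.
by apply: nearW => n; exact: uK.
Qed.

End modulus.

(** * Convergence of the random fields *)

Theorem theorem1 (R : realType) (d : nat) (E : set 'rV[R]_d)
    (theta : R -> R)
    (disp : measure_display) (Omega : measurableType disp)
    (P : probability Omega R) (F : nat -> set (set Omega))
    (xi : nat -> 'rV[R]_d -> Omega -> R)
    (M := fun (n : nat) (w : Omega) =>
       (sup_norm E (fun x => xi n x w)
        + modulus_seminorm E theta (fun x => xi n x w))%E) :
  compact E ->
  modulus_of_continuity theta ->
  measure_is_complete P ->
  filtration F ->
  complete_filtration P F ->
  (forall n, random_field E (xi n)) ->
  (forall n, {ae P, forall w, admits_modulus E theta (fun x => xi n x w)}) ->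
  (forall x, E x -> martingale P F (fun n => xi n x)) ->
  (ereal_sup (range (fun n => \int[P]_w M n w)) < +oo)%E ->
  exists xi_lim : 'rV[R]_d -> Omega -> R,
    [/\ random_field E xi_lim,
        {ae P, forall w, admits_modulus E theta (fun x => xi_lim x w)} &
        {ae P, forall w, forall x, E x ->
           xi n x w @[n --> \oo] --> xi_lim x w}].
Proof.
move=> _ modt _ filF _ rfxi admxi martxi Moo.
have [->|/set0P E0] := eqVneq E set0.
  exists (fun _ _ => 0); split => //; last exact: aeW.
  apply: aeW => w; apply/(admits_modulusP _ modt).
  by exists 0 => // x y [].
have [g [Eg dense_g]] := exists_dense_sequence E0.
have xiM x n w : E x -> (`|xi n x w|%:E <= M n w)%E.
  move=> Ex; rewrite /M -[leLHS]adde0; apply: leeD.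
    exact: (le_sup_norm (fun y => xi n y w)).
  exact: modulus_seminorm_ge0.
have cvg_dense : {ae P, forall w, forall i, cvgn (fun n => xi n (g i) w)}.
  apply: ae_foralln => i; apply: (martingale_ae_cvg filF (martxi _ (Eg i)) Moo).
  move=> n; apply: (@le_trans _ _ (\int[P]_w M n w)%E); last first.
    by apply: ereal_sup_ubound; exists n.
  by apply: ge0_le_integral_nonmeasurable => // w; exact: xiM.
(* The increments over all pairs of points of [g], in one sequence. *)
pose idx (p : nat) := odflt (0, 0)%N (unpickle p : option (nat * nat)).
pose Z (p n : nat) : Omega -> R :=
  (theta (euclidean_norm (g (idx p).1 - g (idx p).2)))^-1 \*o
  (xi n (g (idx p).1) \- xi n (g (idx p).2)).
have ae_K : {ae P, forall w, exists K, forall p n, `|Z p n w| <= K}.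
  apply: (@ae_bounded_dominated_martingales _ _ _ _ _ _ M filF) => //.
    move=> p; apply: martingaleZ => //.
    by apply: martingaleB => //; exact: martxi.
  move=> p n w; rewrite /M -[leLHS]add0e; apply: leeD.
    exact: sup_norm_ge0.
  exact: (increment_le_modulus_seminorm modt (fun x => xi n x w)).
have good : {ae P, forall w, exists2 K, 0 <= K &
    (forall n, modulus_bound E theta K (fun x => xi n x w)) /\
    (forall x, E x -> cvgn (fun n => xi n x w))}.
  apply: filterS3 (ae_foralln admxi) cvg_dense ae_K => w adm cvgw [K0 ZK].
  have K0_ge0 : 0 <= K0 by apply: le_trans (ZK 0 0)%N.
  have bound n : modulus_bound E theta K0 (fun x => xi n x w).
    have [L L0 Lxi] := (admits_modulusP _ modt _).1 (adm n).
    apply: (modulus_bound_dense modt Eg dense_g K0_ge0 Lxi) => i j.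
    have := Lxi _ _ (Eg i) (Eg j).
    (* Where [theta] vanishes, [Z] is zero and carries no information; the
       almost sure modulus of [xi n] itself forces the increment to be zero. *)
    have [->|t0] := eqVneq (theta (euclidean_norm (g i - g j))) 0.
      by rewrite !mulr0.
    move=> _; have := ZK (pickle (i, j)) n; rewrite /Z/idx pickleK/=.
    have tpos : 0 < theta (euclidean_norm (g i - g j)).
      rewrite lt0r t0; case: modt => + _ _ _ _; apply.
      exact: euclidean_norm_ge0.
    by rewrite normrM normfV (gtr0_norm tpos) mulrC ler_pdivrMr.
  exists K0 => //; split=> // x Ex.
  exact: (equicontinuous_cvg modt Eg dense_g K0_ge0 bound).
pose xi_lim x w := fine (limn_esup (fun n => (xi n x w)%:E)).
have lim_xi x w : cvgn (fun n => xi n x w) ->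
    xi n x w @[n --> \oo] --> xi_lim x w.
  move=> /cvg_ex[l xl]; suff -> : xi_lim x w = l by [].
  have xlE : (xi n x w)%:E @[n --> \oo] --> l%:E.
    by apply: cvg_EFin => //; exact: nearW.
  by rewrite /xi_lim; have [_ ->] := cvg_limn_einf_sup xlE.
exists xi_lim; split.
- move=> x Ex; apply: measurableT_comp; first exact: fine_measurable.
  apply: measurable_fun_limn_esup => n; apply/measurable_EFinP.
  exact: rfxi.
- apply: filterS good => w [K K0 [Kxi cvgw]].
  apply/(admits_modulusP _ modt); exists K => //.
  by apply: (modulus_bound_lim Kxi) => x Ex; exact: lim_xi (cvgw x Ex).
- by apply: filterS good => w [K K0 [_ cvgw]] x Ex; exact: lim_xi (cvgw x Ex).
Qed.
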